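(* Let $A\in\mathbb{C}^{n\times n}$. Then: (a) $\mathbf{W}_\pi(A)$ is compact, and it may fail to be convex (i.e. there exist $n$ and $A\in\mathbb{C}^{n\times n}$ for which $\mathbf{W}_\pi(A)$ is not convex). (b) $\mathbf{W}_\pi(A)=\{0\}$ if and only if $A$ is skew-symmetric, i.e. $A^\top=-A$. (c) $r_\pi(\cdot)$ is a norm on the complex vector space $\{A\in\mathbb{C}^{n\times n}:A^\top=A\}$ of complex symmetric matrices.
   Context: For $A\in\mathbb{C}^{n\times n}$ the pseudo-numerical range is $\mathbf{W}_\pi(A)=\{\mathbf{x}^\top A\mathbf{x}:\mathbf{x}\in\mathbb{C}^n,\|\mathbf{x}\|=1\}$ (transpose, not conjugate transpose) and the pseudo-numerical radius is $r_\pi(A)=\max\{|\mathbf{x}^\top A\mathbf{x}|:\mathbf{x}\in\mathbb{C}^n,\|\mathbf{x}\|=1\}$, where $\|\mathbf{x}\|=\sqrt{\mathbf{x}^*\mathbf{x}}$. *)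

(* Defs.v *)
From mathcomp Require Import all_boot all_order all_algebra.
From mathcomp Require Export complex.
From mathcomp Require Import all_classical all_reals all_analysis.
Import Order.TTheory GRing.Theory Num.Theory.
Import numFieldNormedType.Exports.

Set Implicit Arguments.
Unset Strict Implicit.
Unset Printing Implicit Defensive.

Local Open Scope classical_set_scope.
Local Open Scope ring_scope.
Local Open Scope complex_scope.
Local Open Scope sesquilinear_scope.

(* The Euclidean norm. The norm `|x| that MathComp-Analysis puts on matrices
   is the maximum of the moduli of the entries, hence this definition.
   The value is a nonnegative real element of R[i]. *)
Definition vnorm (R : realType) (n : nat) (x : 'cV[R[i]]_n) : R[i] :=
  sqrtC ((x ^t* *m x) 0 0).

(* R[i]^o is R[i] as a module over itself, the type on which the library has
   the topology of the modulus and the convex combinations. *)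
Definition pnum_range (R : realType) (n : nat) (A : 'M[R[i]]_n) : set R[i]^o :=
  [set (x^T *m A *m x) 0 0 | x in [set x : 'cV[R[i]]_n | vnorm x = 1]].

(* The largest element of S; 0 if S has no largest element. *)
Definition set_max (R : realType) (S : set R) : R :=
  xget 0 [set m | S m /\ ubound S m].

Definition pnum_radius (R : realType) (n : nat) (A : 'M[R[i]]_n) : R :=
  set_max [set Normc.normc z | z in pnum_range A].

Definition symmetric_mx (R : realType) (n : nat) : {pred 'M[R[i]]_n} :=
  [pred A | A^T == A].

Record is_norm_on (R : realType) (V : lmodType R[i]) (S : {pred V})
    (N : V -> R) : Prop := IsNormOn {
  norm_on_subspace : GRing.submod_closed S;
  norm_on_ge0 : forall v, v \in S -> 0 <= N v;
  norm_on_eq0 : forall v, v \in S -> (N v = 0 <-> v = 0);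
  norm_onZ : forall (a : R[i]) v, v \in S -> N (a *: v) = Normc.normc a * N v;
  norm_onD : forall u v, u \in S -> v \in S -> N (u + v) <= N u + N v
}.

(* Main.v *)
Require Import Defs.
From mathcomp Require Import all_boot all_order all_algebra.
From mathcomp Require Import all_classical all_reals all_analysis.
Import Order.TTheory GRing.Theory Num.Theory.
Import numFieldNormedType.Exports.

Local Open Scope classical_set_scope.
Local Open Scope ring_scope.
Local Open Scope complex_scope.

(** Write [q_A x = x^T A x].  Everything follows from two facts.

    Topology: splitting each coordinate into its real and imaginary parts
    identifies the unit sphere of C^n with the Euclidean unit sphere of
    R^(2n), which is compact, and [q_A] is a polynomial in these 2n real
    coordinates.  So the pseudo-numerical range is the continuous image of a
    compact set, hence compact ([pnum_range_compact]), and the modulus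
    attains its maximum on it ([pnum_radius_attained]).

    Algebra: [q_(A^T) = q_A], so [q_A] vanishes when [A] is skew-symmetric.
    Conversely, since [q_A (c x) = c^2 q_A x], vanishing on the unit sphere
    means vanishing everywhere, and polarization on the basis vectors gives
    [A i j + A j i = 0] ([qform_unit_eq0_skew]).

    The norm axioms then come from evaluating at a maximizer, [q_A x] being
    linear in [A]; definiteness holds because a matrix both symmetric and
    skew-symmetric is zero.  Convexity already fails for the 1 x 1 identity
    matrix, whose range is the unit circle: the midpoint of 1 and -1 is
    missing ([pnum_range_scalar1]). *)

(** * The quadratic form of a square matrix *)

Definition qform {K : comPzRingType} {n : nat} (A : 'M[K]_n) (x : 'cV[K]_n) :
  K := (x^T *m A *m x) 0 0.

Section QuadraticForm.
Variables (K : comPzRingType) (n : nat).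
Implicit Types (A B : 'M[K]_n) (x y : 'cV[K]_n).

Lemma qformE A x : qform A x = \sum_j (\sum_i x i 0 * A i j) * x j 0.
Proof.
rewrite /qform mxE; apply: eq_bigr => j _; congr (_ * _).
by rewrite mxE; apply: eq_bigr => i _; rewrite mxE.
Qed.

Lemma qformZ A (c : K) x : qform A (c *: x) = c ^+ 2 * qform A x.
Proof.
rewrite /qform [(c *: x)^T]linearZ /= -scalemxAr -!scalemxAl scalerA.
by rewrite mxE expr2.
Qed.

Lemma qformDl A B x : qform (A + B) x = qform A x + qform B x.
Proof. by rewrite /qform mulmxDr mulmxDl mxE. Qed.

Lemma qformNl A x : qform (- A) x = - qform A x.
Proof. by rewrite /qform mulmxN mulNmx mxE. Qed.

Lemma qformZl (c : K) A x : qform (c *: A) x = c * qform A x.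
Proof. by rewrite /qform -scalemxAr -scalemxAl mxE. Qed.

Lemma trmx11E (M : 'M[K]_1) : M^T 0 0 = M 0 0.
Proof. by rewrite mxE. Qed.

Lemma qform_trmx A x : qform A^T x = qform A x.
Proof. by rewrite /qform -[RHS]trmx11E !trmx_mul trmxK mulmxA. Qed.

(** Polarization: the bilinear form attached to [qform A] is the one of the
    symmetric part of [A], up to a factor 2 that is kept inside so that no
    division is needed. *)
Lemma qformD A x y :
  qform A (x + y) = qform A x + qform A y + (x^T *m (A + A^T) *m y) 0 0.
Proof.
have -> : (x^T *m (A + A^T) *m y) 0 0 =
    (x^T *m A *m y) 0 0 + (y^T *m A *m x) 0 0.
  rewrite mulmxDr mulmxDl mxE; congr (_ + _).
  by rewrite -[LHS]trmx11E !trmx_mul !trmxK mulmxA.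
rewrite /qform [(x + y)^T]linearD /= !(mulmxDl, mulmxDr) !mxE.
by rewrite [X in _ + X = _]addrC addrACA; congr (_ + _); rewrite addrC.
Qed.

(** Polarizing at two basis vectors isolates the entry [(i, j)] of
    [A + A^T]. *)
Lemma qform_eq0_skew A : (forall x, qform A x = 0) -> A^T = - A.
Proof.
move=> q0; apply/eqP; rewrite -addr_eq0 addrC; apply/eqP/matrixP => i j.
have := qformD A (delta_mx i 0) (delta_mx j 0).
rewrite !q0 !add0r trmx_delta -rowE => /esym.
by rewrite -colE !mxE.
Qed.

End QuadraticForm.

(** * Continuity of complex-valued functions *)

Section PseudoNumericalRange.
Variable R : realType.

Lemma real_complex_continuous : continuous (fun x : R => x%:C : R[i]^o).
Proof.
move=> x; apply/cvgrPdist_lt => eps; rewrite ltcE /= => /andP[/eqP e0 e_gt0].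
near=> y.
rewrite -rmorphB normc_def /= expr0n addr0 sqrtr_sqr ltcE /= e0 eqxx /=.
by near: y; exact: (@cvgr_dist_lt _ _ _ (nbhs x) _ idfun x).
Unshelve. all: by end_near. Qed.

Lemma continuous_sum {K : numFieldType}
    {T : topologicalType} (I : Type) (r : seq I) (f : I -> T -> K) :
  (forall i, continuous (f i)) -> continuous (fun t => \sum_(i <- r) f i t).
Proof.
move=> cf t; elim: r => [|i r IHr].
  by under eq_fun do rewrite big_nil; exact: cvg_cst.
under eq_fun do rewrite big_cons.
by apply: cvgD => //; exact: cf.
Qed.

Lemma continuous_mul {K : numFieldType} {T : topologicalType} (f g : T -> K) :
  continuous f -> continuous g -> continuous (fun t => f t * g t).
Proof. by move=> cf cg t; apply: cvgM; [exact: cf|exact: cg]. Qed.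

Lemma complex_continuous {T : topologicalType} (f g : T -> R) :
  continuous f -> continuous g ->
  continuous (fun t => f t +i* g t : R[i]^o).
Proof.
move=> cf cg t.
have E u : f u +i* g u = (f u)%:C + 'i * (g u)%:C by exact: complexE (_ +i* _).
under eq_fun do rewrite E.
have cC (h : T -> R) : continuous h -> continuous (fun u => (h u)%:C : R[i]^o).
  move=> ch u; exact: continuous_comp (ch u) (real_complex_continuous (h u)).
apply: (@cvgD _ R[i]^o); first exact: cC.
apply: (@cvgM R[i]); first exact: cvg_cst.
exact: cC.
Qed.

(** The reverse triangle inequality makes the modulus 1-Lipschitz. *)
Lemma normc_continuous : continuous (@Normc.normc R : R[i]^o -> R).
Proof.
move=> z P /nbhs_ballP[e /= e_gt0 eP]; apply/(@nbhs_ballP _ R[i]^o).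
exists e%:C; first by rewrite /= ltcR.
move=> w zw; apply: eP; rewrite /ball /= -ltcR; apply: le_lt_trans zw.
have normE (u : R[i]) : `|u| = (Normc.normc u)%:C by [].
have := ler_dist_dist z w; rewrite !normE -rmorphB /=.
by rewrite expr0n addr0 sqrtr_sqr.
Qed.

(** * Compactness of the range *)

(** The identification of R^(2n) with C^n: the first [n] coordinates are the
    real parts, the last [n] the imaginary parts. *)
Definition cvec {n : nat} (v : 'rV[R]_(n + n)) : 'cV[R[i]]_n :=
  \col_i (v 0 (lshift n i) +i* v 0 (rshift n i)).

Lemma cvec_surj {n : nat} (x : 'cV[R[i]]_n) : exists v, cvec v = x.
Proof.
exists (row_mx (\row_i complex.Re (x i 0)) (\row_i complex.Im (x i 0))).
apply/colP => i; rewrite mxE row_mxEl row_mxEr !mxE.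
by case: (x i 0).
Qed.

(** Expanded in coordinates, the form is a finite sum of products of
    continuous functions. *)
Lemma qform_cvec_continuous {n : nat} (A : 'M[R[i]]_n) :
  continuous (fun v => qform A (cvec v) : R[i]^o).
Proof.
have cx i : continuous (fun v => @cvec n v i 0 : R[i]^o).
  under eq_fun do rewrite mxE.
  by apply: complex_continuous; exact: coord_continuous.
under eq_fun do rewrite qformE.
apply: (@continuous_sum R[i]) => j.
apply: (@continuous_mul R[i]); last exact: cx.
apply: (@continuous_sum R[i]) => i.
by apply: (@continuous_mul R[i]) => [|v]; [exact: cx|apply: cst_continuous].
Qed.

Definition sphere (m : nat) : set 'rV[R]_m := [set v | \sum_i v 0 i ^+ 2 = 1].

(** The sphere is closed, being a level set of a continuous function, and it
    lies in the cube [-1, 1]^m, a product of compact segments. *)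
Lemma sphere_compact m : compact (sphere m).
Proof.
apply: subclosed_compact (rV_compact (fun=> @segment_compact R (-1) 1)) _.
  have cN : continuous (fun v : 'rV[R]_m => \sum_i v 0 i ^+ 2).
    apply: (@continuous_sum R) => i.
    by apply: (@continuous_mul R); exact: coord_continuous.
  have -> : sphere m = (fun v : 'rV[R]_m => \sum_i v 0 i ^+ 2) @^-1` [set 1].
    by [].
  by apply: preimage_closed => [v _|]; [exact: cN|exact: closed_eq].
move=> v /= v1 i; rewrite in_itv /= -ler_norml -(@expr_le1 _ 2) //.
rewrite real_normK ?num_real // -v1 (bigD1 i) //= lerDl.
by apply: sumr_ge0 => j _; exact: sqr_ge0.
Qed.

Lemma vnormE {n : nat} (x : 'cV[R[i]]_n) :
  vnorm x = sqrtC (\sum_i `|x i 0| ^+ 2).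
Proof.
rewrite /vnorm mxE; congr sqrtC; apply: eq_bigr => i _.
by rewrite !mxE normCKC.
Qed.

(** [cvec] is isometric, since |a + i b|^2 = a^2 + b^2. *)
Lemma vnorm_cvec {n : nat} (v : 'rV[R]_(n + n)) :
  vnorm (cvec v) = 1 <-> sphere _ v.
Proof.
have sumE : \sum_i `|cvec v i 0| ^+ 2 = (\sum_i v 0 i ^+ 2)%:C.
  rewrite big_split_ord /= -big_split rmorph_sum /=.
  by apply: eq_bigr => i _; rewrite -add_Re2_Im2 mxE.
rewrite vnormE sumE /sphere /=; split=> [v1|->]; last exact: sqrtC1.
by apply: complexI; rewrite -[LHS]sqrtCK v1 expr1n.
Qed.

Lemma pnum_rangeE {n : nat} (A : 'M[R[i]]_n) :
  pnum_range A = [set qform A (cvec v) | v in sphere _].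
Proof.
rewrite predeqE => z; split=> [[x /= x1 <-]|[v /vnorm_cvec v1 <-]].
  have [v vx] := cvec_surj x.
  by exists v; [apply/vnorm_cvec; rewrite vx|rewrite vx].
by exists (cvec v).
Qed.

Lemma pnum_range_compact {n : nat} (A : 'M[R[i]]_n) : compact (pnum_range A).
Proof.
rewrite pnum_rangeE; apply: continuous_compact; last exact: sphere_compact.
exact/continuous_subspaceT/qform_cvec_continuous.
Qed.

Lemma pnum_range_neq0 {n : nat} (A : 'M[R[i]]_n) :
  (0 < n)%N -> pnum_range A !=set0.
Proof.
case: n A => // n A _; exists (qform A (delta_mx 0 0)), (delta_mx 0 0) => //=.
rewrite vnormE (bigD1 0) //= big1 => [|i /negPf i0].
  by rewrite mxE eqxx normr1 expr1n addr0 sqrtC1.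
by rewrite mxE i0 normr0 expr0n.
Qed.

(** * The range is zero exactly for skew-symmetric matrices *)

Lemma exists_unit_multiple {n : nat} (x : 'cV[R[i]]_n) :
  x != 0 -> exists2 c, c != 0 & vnorm (c *: x) = 1.
Proof.
move=> x_neq0; have s_ge0 : 0 <= \sum_i `|x i 0| ^+ 2.
  by apply: sumr_ge0 => i _; exact: exprn_ge0.
have N_neq0 : vnorm x != 0.
  apply: contra x_neq0; rewrite vnormE sqrtC_eq0 psumr_eq0 => [/allP s0|i _].
    apply/eqP/colP => i; have := s0 i (mem_index_enum _).
    by rewrite mxE expf_eq0 /= normr_eq0 => /eqP.
  exact: exprn_ge0.
exists (vnorm x)^-1; first by rewrite invr_eq0.
rewrite vnormE; under eq_bigr do rewrite mxE normrM exprMn.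
rewrite -mulr_sumr -[X in _ * X]sqrtCK -vnormE ger0_norm.
  by rewrite exprVn mulVf ?sqrtC1 // expf_neq0.
by rewrite invr_ge0 vnormE sqrtC_ge0.
Qed.

(** Homogeneity of degree 2 carries the vanishing from the unit sphere to the
    whole space, where polarization applies. *)
Lemma qform_unit_eq0_skew {n : nat} (A : 'M[R[i]]_n) :
  (forall x, vnorm x = 1 -> qform A x = 0) -> A^T = - A.
Proof.
move=> q1; apply: qform_eq0_skew => x.
have [->|/exists_unit_multiple[c c0 cx1]] := eqVneq x 0.
  by rewrite -[0](scale0r 0) qformZ expr0n mul0r.
by move/eqP: (q1 _ cx1); rewrite qformZ mulf_eq0 expf_eq0 (negPf c0) => /eqP.
Qed.

(** [qform A x] equals both [qform A^T x] and, by skew-symmetry, the opposite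
    of it. *)
Lemma skew_qform_eq0 {n : nat} (A : 'M[R[i]]_n) x : A^T = - A -> qform A x = 0.
Proof.
move=> skewA; have := qform_trmx _ _ A x; rewrite skewA qformNl => /esym/eqP.
by rewrite -addr_eq0 -mulr2n mulrn_eq0 => /eqP.
Qed.

Lemma pnum_range_eq0 {n : nat} (A : 'M[R[i]]_n) :
  (0 < n)%N -> (pnum_range A = [set 0] <-> A^T = - A).
Proof.
move=> n_gt0; split=> [W0|skewA].
  apply: qform_unit_eq0_skew => x x1.
  by have : pnum_range A (qform A x) by [exists x]; rewrite W0.
apply/seteqP; split=> [_ [x _ <-]|_ ->]; first exact: skew_qform_eq0.
have [_ [x x1 _]] := pnum_range_neq0 A n_gt0.
by exists x => //; exact: skew_qform_eq0.
Qed.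

(** * The radius is a norm on symmetric matrices *)

(** The radius is a genuine maximum, by the extreme value theorem; the
    homogeneity and the triangle inequality need both the maximizer and the
    upper bound. *)
Lemma pnum_radius_attained {n : nat} (A : 'M[R[i]]_n) : (0 < n)%N ->
  exists x, [/\ vnorm x = 1, pnum_radius A = Normc.normc (qform A x) &
    forall y, vnorm y = 1 -> Normc.normc (qform A y) <= pnum_radius A].
Proof.
move=> n_gt0.
have normc_within :
  {within pnum_range A, continuous (@Normc.normc R : R[i]^o -> R)}.
  exact/continuous_subspaceT/normc_continuous.
have [z] := compact_EVT_max (pnum_range_neq0 A n_gt0) (pnum_range_compact A)
  normc_within.
rewrite inE => -[x x1 <-] max_x.
have ub y : vnorm y = 1 -> Normc.normc (qform A y) <= Normc.normc (qform A x).
  by move=> y1; apply: max_x; rewrite inE; exists y.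
have -> : pnum_radius A = Normc.normc (qform A x); last by exists x.
apply: xget_unique => [|m [[_ [y y1 <-] <-] ub_y]].
  split; first by exists (qform A x) => //; exists x.
  by move=> _ [_ [y y1 <-] <-]; exact: ub.
apply/eqP; rewrite eq_le ub // ub_y //=.
by exists (qform A x) => //; exists x.
Qed.

Lemma normc_ge0 (z : R[i]) : 0 <= Normc.normc z.
Proof. by case: z => a b; exact: sqrtr_ge0. Qed.

Lemma symmetric_mx_closed n : submod_closed (@symmetric_mx R n).
Proof.
split=> [|c A B /eqP symA /eqP symB]; first by rewrite inE trmx0.
by rewrite inE linearP /= symA symB.
Qed.

Lemma symmetric_skew_eq0 {n : nat} (A : 'M[R[i]]_n) :
  A \in @symmetric_mx R n -> A^T = - A -> A = 0.
Proof.
move=> /eqP -> /eqP; rewrite -addr_eq0 -mulr2n => A0; apply/matrixP => i j.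
move/eqP/matrixP/(_ i j)/eqP: A0.
by rewrite mulr2n !mxE -mulr2n mulrn_eq0 => /eqP.
Qed.

Lemma pnum_radius_norm n :
  (0 < n)%N -> is_norm_on (@symmetric_mx R n) (@pnum_radius R n).
Proof.
move=> n_gt0; split; first exact: symmetric_mx_closed.
- move=> A _; have [x [_ -> _]] := pnum_radius_attained A n_gt0.
  exact: normc_ge0.
- move=> A symA; have [x [x1 rA ubA]] := pnum_radius_attained A n_gt0.
  split=> [rA0|A0]; last first.
    by rewrite rA A0 -(scale0r 0) qformZl mul0r Normc.normc0.
  apply: symmetric_skew_eq0 symA _; apply: qform_unit_eq0_skew => y y1.
  apply: Normc.eq0_normc; apply: le_anti.
  by rewrite -{1}rA0 ubA // normc_ge0.
- move=> c A _; have [x [x1 rA ubA]] := pnum_radius_attained A n_gt0.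
  have [y [y1 rcA ubcA]] := pnum_radius_attained (c *: A) n_gt0.
  (* A maximizer for either matrix is a competitor for the other one. *)
  apply/le_anti/andP; split.
    by rewrite rcA qformZl Normc.normcM ler_wpM2l ?normc_ge0 ?ubA.
  by rewrite rA -Normc.normcM -qformZl ubcA.
- move=> A B _ _; have [x [x1 -> _]] := pnum_radius_attained (A + B) n_gt0.
  have [_ [_ _ ubA]] := pnum_radius_attained A n_gt0.
  have [_ [_ _ ubB]] := pnum_radius_attained B n_gt0.
  rewrite qformDl; apply: le_trans (le_normcD _ _) _.
  by apply: lerD; [exact: ubA|exact: ubB].
Qed.

(** * A range that is not convex *)

(** Both 1 = 1^2 and -1 = i^2 belong to the range [{x^2 : |x| = 1}], but their
    midpoint 0 does not. *)
Lemma pnum_range_scalar1 : ~ convex_set (pnum_range (1%:M : 'M[R[i]]_1)).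
Proof.
have q1 (c : R[i]) : qform 1%:M (c%:M : 'cV_1) = c ^+ 2.
  by rewrite /qform mulmx1 tr_scalar_mx -scalar_mxM mxE eqxx mulr1n.
have N1 (x : 'cV[R[i]]_1) : vnorm x = `|x 0 0|.
  by rewrite vnormE big_ord1 sqrCK.
have in_range (c : R[i]) :
    `|c| = 1 -> c ^+ 2 \in pnum_range (1%:M : 'M[R[i]]_1).
  move=> c1; rewrite inE; exists c%:M; last exact: q1.
  by rewrite /= N1 mxE eqxx mulr1n.
have half_ge0 : 0 <= 2^-1 :> R[i] by rewrite invr_ge0.
have half_le1 : 2^-1 <= 1 :> R[i] by rewrite invf_le1 ?ler1n.
move=> /(_ (1 ^+ 2) ('i ^+ 2) (Itv01 half_ge0 half_le1)).
move=> /(_ (in_range _ (normr1 _)) (in_range _ (normCi _))).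
rewrite inE => -[x /= x1].
rewrite -[RHS]/(2^-1 * 1 ^+ 2 + (1 - 2^-1) * 'i ^+ 2 : R[i]) sqrCi expr1n.
rewrite mulrN1 mulr1 opprB addrA.
rewrite -[X in X + _ - _]mul1r -[X in _ + X - _]mul1r -splitr subrr.
rewrite [x]mx11_scalar -/(qform _ _) q1 => /eqP; rewrite expf_eq0 /= => /eqP x0.
by move/eqP: x1; rewrite /= N1 x0 normr0 eq_sym oner_eq0.
Qed.

End PseudoNumericalRange.

Theorem lemma6p2 (R : realType) :
  [/\ (forall (n : nat) (A : 'M[R[i]]_n), (0 < n)%N ->
         compact (pnum_range A)) /\
      (exists (n : nat) (A : 'M[R[i]]_n), (0 < n)%N /\
         ~ convex_set (pnum_range A)),
      forall (n : nat) (A : 'M[R[i]]_n), (0 < n)%N ->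
        (pnum_range A = [set 0] <-> A^T = - A) &
      forall n : nat, (0 < n)%N ->
        is_norm_on (@symmetric_mx R n) (@pnum_radius R n)].
Proof.
split; last by move=> n; exact: pnum_radius_norm.
  split=> [n A _|]; first exact: pnum_range_compact.
  by exists 1, 1%:M; split=> //; exact: pnum_range_scalar1.
by move=> n A; exact: pnum_range_eq0.
Qed.
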